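(* Let $m\ge1$ be an integer and $b$ a complex number. Let $f_m(z,0,b)=\sum_{n\ge0}c(n,m,0,b)z^n$ be the unique formal power series with $f_m=1+bz^mf_m^2$, and $d_0^{(m)}(N,0,b)=\det\big(c(i+j,m,0,b)\big)_{i,j=0}^{N-1}$. Then for all $n\ge0$ $$d_0^{(m)}(mn,0,b)=(-1)^{\binom{m-1}{2}n}b^{n(mn-1)},\qquad d_0^{(m)}(mn+1,0,b)=(-1)^{\binom{m-1}2n}b^{n(mn+1)},$$ and $d_0^{(m)}(N,0,b)=0$ for all $N\ge0$ not of the form $mn$ or $mn+1$.
   Context: The determinant of a $0\times0$ matrix is $1$. *)

(* Defs.v *)
From HB Require Import structures.
From mathcomp Require Import all_boot all_order all_algebra.
Set Implicit Arguments.
Unset Strict Implicit.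
Unset Printing Implicit Defensive.
Import GRing.Theory.
Local Open Scope ring_scope.

(* A formal power series is identified with its sequence of coefficients:
   [f n] is the coefficient of z^n. *)
Definition fps (K : nzRingType) : Type := nat -> K.

Section FormalPowerSeries.
Variable K : nzRingType.
Implicit Types f g : fps K.

Definition fps_one : fps K := fun n => (n == 0%N)%:R.

Definition fps_Xn (m : nat) : fps K := fun n => (n == m)%:R.

Definition fps_add f g : fps K := fun n => f n + g n.

Definition fps_scale (a : K) f : fps K := fun n => a * f n.

Definition fps_mul f g : fps K := fun n => \sum_(i < n.+1) f i * g (n - i)%N.

Definition fm_equation (m : nat) (b : K) f : Prop :=
  f = fps_add fps_one
        (fps_scale b (fps_mul (fps_Xn m) (fps_mul f f))).

End FormalPowerSeries.

Arguments fps_one {K}.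
Arguments fps_Xn {K} m.

Definition hankel_det (K : comNzRingType) (c : nat -> K) (N : nat) : K :=
  \det (\matrix_(i < N, j < N) c (i + j)%N).

(* Main.v *)
Require Import Defs.
From mathcomp Require Import all_boot all_order all_algebra.
From mathcomp Require Import boolp reals.
From mathcomp Require Import complex.
From mathcomp Require Import zify ring.
Set Implicit Arguments.
Unset Strict Implicit.
Unset Printing Implicit Defensive.
Import GRing.Theory.
Local Open Scope ring_scope.
Local Open Scope complex_scope.

(** Let p(n, k) be the weighted number of Dyck prefixes of length n ending at
    height k.  The last-passage decomposition gives c(mq) = p(2q, 0), the other
    coefficients being zero.  Symmetry of the transfer operator gives
    sum_k b^k p(i, k) p(j, k) = p(i + j, 0).  Attach to the index i = mq + r the
    height [level i] = 2q if r = 0 and 2q + 1 otherwise; if m divides i + j then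
    the levels of i and j add up to 2(i + j)/m.  Hence the Hankel matrix factors
    as L D L^T, where L is lower unitriangular with entries p(level i, level k)
    for i = k mod m, and D couples k only with the index of the same block
    {mq, ..., mq + m - 1} whose residue is opposite to that of k.  Each block of
    D is a 1 x 1 block b^(2q) followed by an antidiagonal block b^(2q+1) of size
    m - 1; cutting the latter strictly inside leaves a zero row. *)

(** * Finite sums supported on one residue class *)

Section Sums.
Variable V : nmodType.
Implicit Types (F : nat -> V).

Lemma sum_ord_widen F n1 n2 : (n1 <= n2)%N ->
    (forall k, (n1 <= k)%N -> F k = 0) ->
  \sum_(k < n1) F k = \sum_(k < n2) F k.
Proof.
move=> le12 F0; rewrite (big_ord_widen _ F le12) big_mkcond.
by apply: eq_bigr => k _; case: ltnP => // /F0.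
Qed.

(** Applied with [d = m] to indices and with [d = 2] to path lengths and heights. *)
Lemma sum_ord_residue F d r M : (r < d)%N ->
    (forall k, (k %% d)%N != r -> F k = 0) ->
  \sum_(k < d * M) F k = \sum_(q < M) F (d * q + r)%N.
Proof.
move=> ltrd F0; elim: M => [|M IHM]; first by rewrite muln0 !big_ord0.
rewrite mulnSr big_split_ord /= IHM big_ord_recr /=; congr (_ + _).
rewrite (bigD1 (Ordinal ltrd)) //= big1 ?addr0 // => i ne_ir.
by apply: F0; rewrite mulnC modnMDl modn_small.
Qed.

End Sums.

(** * Weighted Dyck prefixes and their convolution identities *)

Section DyckPrefixes.
Variables (K : comNzRingType) (b : K).

(* Weighted count of the nonnegative lattice paths with [n] steps +1, -1 from
   height 0 to height [k], each down step having weight [b]. *)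
Fixpoint dyck (n k : nat) : K :=
  if n is n'.+1 then
    (if k is k'.+1 then dyck n' k' else 0) + b * dyck n' k.+1
  else (k == 0%N)%:R.

Lemma dyck_gt n k : (n < k)%N -> dyck n k = 0.
Proof.
elim: n k => [|n IHn] [|k] //= ltnk.
by rewrite !IHn ?mulr0 ?addr0 //; lia.
Qed.

Lemma dyck_odd n k : odd (n + k) -> dyck n k = 0.
Proof.
elim: n k => [|n IHn] [|k] //= odd_nk.
  by rewrite IHn ?mulr0 ?addr0 //; lia.
by rewrite !IHn ?mulr0 ?addr0 //; lia.
Qed.

Lemma dyck_diag n : dyck n n = 1.
Proof.
by elim: n => //= n ->; rewrite dyck_gt ?mulr0 ?addr0 //; lia.
Qed.

(* Split a path at its last visit to height [k]. *)
Lemma dyck_last_passage n k :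
  dyck n.+1 k.+1 = \sum_(i < n.+1) dyck i k * dyck (n - i) 0.
Proof.
elim: n k => [|n IHn] k.
  by rewrite big_ord1 /= mulr0 addr0 mulr1.
rewrite big_ord_recl subn0.
under eq_bigr => i _ do rewrite /bump /= subSS mulrDl -mulrA.
rewrite big_split /= -big_distrr /= -IHn.
case: k => [|k] /=.
  by rewrite big1 ?mul1r ?add0r // => i _; rewrite mul0r.
by rewrite -IHn mul0r add0r.
Qed.

Lemma dyck_return n :
  dyck n.+2 0 = b * \sum_(i < n.+1) dyck i 0 * dyck (n - i) 0.
Proof. by rewrite -dyck_last_passage /= add0r. Qed.

(* The transfer operator is symmetric for the weights [b ^+ k], so that steps
   can be moved from one factor to the other. *)
Lemma dyck_moment M i j : (i < M)%N ->
  \sum_(k < M) b ^+ k * dyck i k * dyck j k = dyck (i + j) 0.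
Proof.
elim: i j M => [|i IHi] j [|M] // ltiM.
  rewrite big_ord_recl big1 ?addr0 ?expr0 ?mul1r // => k _.
  by rewrite /bump /= mulr0 mul0r.
rewrite addSnnS -(IHi _ M.+1) 1?ltnW //.
(* Up steps of one factor become down steps of the other by shifting [k]. The boundary terms vanish:
   no up step ends at height 0, and a path of length [u < M] cannot reach the top height. *)
have shift u v : (u < M)%N ->
   \sum_(k < M.+1) b ^+ k * (if val k is k'.+1 then dyck u k' else 0) * dyck v k
   = \sum_(k < M.+1) b ^+ k.+1 * dyck u k * dyck v k.+1.
  move=> ltuM; rewrite big_ord_recl [RHS]big_ord_recr /= mulr0 mul0r add0r.
  by rewrite (dyck_gt ltuM) mulr0 mul0r addr0.
have shift' u v : (u < M)%N ->
   \sum_(k < M.+1) b ^+ k * dyck u k * (if val k is k'.+1 then dyck v k' else 0)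
   = \sum_(k < M.+1) b ^+ k.+1 * dyck u k.+1 * dyck v k.
  move=> ltuM; rewrite big_ord_recl [RHS]big_ord_recr /= mulr0 add0r.
  by rewrite (@dyck_gt u) ?mulr0 ?mul0r ?addr0 // ltnW.
under eq_bigr => k _ do rewrite /= mulrDr mulrDl.
under [RHS]eq_bigr => k _ do rewrite /= mulrDr.
rewrite !big_split /= shift // shift' // addrC; congr (_ + _).
  by apply: eq_bigr => k _; rewrite exprSr !mulrA.
by apply: eq_bigr => k _; rewrite exprSr -!mulrA; congr (_ * _); ring.
Qed.

End DyckPrefixes.

(** * Existence and uniqueness of the series solution *)

Section Series.
Variables (K : comNzRingType) (m : nat) (b : K).
Hypothesis m_gt0 : (0 < m)%N.

(** The value at [m * q] is [b ^+ q] times the q-th Catalan number. *)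
Definition fm_sol : fps K :=
  fun n => if (m %| n)%N then dyck b (n %/ m).*2 0 else 0.

Lemma fps_mul_Xn (g : fps K) n :
  fps_mul (fps_Xn m) g n = if (m <= n)%N then g (n - m)%N else 0.
Proof.
rewrite /fps_mul /fps_Xn; case: leqP => [lemn | ltnm].
  rewrite (bigD1 (Ordinal (lemn : m < n.+1)%N)) //= eqxx mul1r big1 ?addr0 //.
  by move=> i ne_im; rewrite (negPf (ne_im : nat_of_ord i != m)) mul0r.
rewrite big1 // => i _; rewrite ltn_eqF ?mul0r //.
by have := ltn_ord i; lia.
Qed.

Lemma fm_equationP (f : fps K) : fm_equation m b f <->
  forall n, f n = (n == 0%N)%:R
    + b * (if (m <= n)%N then \sum_(i < (n - m).+1) f i * f (n - m - i)%N
           else 0).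
Proof.
split=> [eq_f n | eq_f].
  by rewrite {1}eq_f /fps_add /fps_scale fps_mul_Xn.
by apply/funext => n; rewrite {1}eq_f /fps_add /fps_scale fps_mul_Xn.
Qed.

(** As [m > 0], the coefficient of index [n] is determined by those of index at most [n - m]. *)
Lemma fm_equation_uniq (f g : fps K) :
  fm_equation m b f -> fm_equation m b g -> f = g.
Proof.
move=> /fm_equationP eq_f /fm_equationP eq_g; apply/funext => n.
elim/ltn_ind: n => n IHn; rewrite eq_f eq_g; congr (_ + b * _).
case: leqP => // lemn; apply: eq_bigr => i _.
by have := ltn_ord i => lti; rewrite !IHn //; lia.
Qed.

Lemma dyck_double_rec n : dyck b n.+1.*2 0 =
  b * \sum_(i < n.+1) dyck b i.*2 0 * dyck b (n - i).*2 0.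
Proof.
rewrite doubleS dyck_return; congr (_ * _).
(* Padding with zeros extends the range to a whole number of periods modulo 2; the odd terms vanish
   by parity. *)
pose F i := if (i <= n.*2)%N then dyck b i 0 * dyck b (n.*2 - i) 0 else 0.
transitivity (\sum_(i < 2 * n.+1) F i).
  rewrite -(@sum_ord_widen _ F n.*2.+1); last 2 first.
  - by lia.
  - by move=> k; rewrite /F; case: leqP => //; lia.
  by apply: eq_bigr => i _; rewrite /F -ltnS ltn_ord.
rewrite (@sum_ord_residue _ F 2 0) // => [|k]; last first.
  rewrite modn2 eqb0 negbK => odd_k; rewrite /F dyck_odd ?addn0 // mul0r.
  by case: ifP.
apply: eq_bigr => i _; rewrite /F addn0 mul2n leq_double -ltnS ltn_ord.
by rewrite doubleB.
Qed.

(** On multiples of [m] the convolution reduces to the Catalan recursion [dyck_double_rec];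
    elsewhere no product survives, since multiples of [m] add up to multiples of [m]. *)
Lemma fm_sol_equation : fm_equation m b fm_sol.
Proof.
apply/fm_equationP => n; rewrite /fm_sol.
have [dvd_mn | ndvd_mn] := boolP (m %| n)%N; last first.
  rewrite (_ : (n == 0)%N = false) ?add0r; last first.
    by apply/eqP => n0; rewrite n0 dvdn0 in ndvd_mn.
  case: leqP => lemn; rewrite ?mulr0 // big1 ?mulr0 // => i _.
  case: ifP => [dvd_i|]; rewrite ?mul0r //.
  case: ifP => [dvd_ni|]; rewrite ?mulr0 //.
  case/negP: ndvd_mn; have lti := ltn_ord i.
  have -> : n = (m + i + (n - m - i))%N by lia.
  by rewrite !dvdn_addr.
case/dvdnP: dvd_mn => -[|q] ->{n}.
  by rewrite div0n leqn0 [(m == 0)%N]eqn0Ngt m_gt0 mulr0 addr0.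
rewrite mulnK // muln_eq0 eqn0Ngt [(m == 0)%N]eqn0Ngt m_gt0 add0r mulSn leq_addr addKn.
rewrite dyck_double_rec; congr (_ * _).
pose F i := if (i <= q * m)%N then fm_sol i * fm_sol (q * m - i)%N else 0.
transitivity (\sum_(i < m * q.+1) F i); last first.
  rewrite -(@sum_ord_widen _ F (q * m).+1).
  - by apply: eq_bigr => i _; rewrite /F -ltnS ltn_ord.
  - by rewrite mulnS mulnC; lia.
  by move=> k; rewrite /F; case: leqP => //; lia.
rewrite (@sum_ord_residue _ F m 0) // => [|k ndvd_k]; last first.
  by rewrite /F /fm_sol /dvdn (negPf ndvd_k) mul0r; case: ifP.
apply: eq_bigr => i _.
rewrite /F addn0 (mulnC q) leq_pmul2l // -ltnS ltn_ord /fm_sol dvdn_mulr //.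
by rewrite mulKn // -mulnBr dvdn_mulr // mulKn.
Qed.

End Series.

(** * Determinants of block triangular and antidiagonal matrices *)

Section NatMatrixDet.
Variable K : comNzRingType.
Implicit Types d : nat -> nat -> K.

(** Entries come from a function on [nat], so that the lower right block has the same form with
    shifted indices. *)
Lemma det_nat_block d n1 n2 :
    (forall i j, (i < n1 <= j)%N -> (j < n1 + n2)%N -> d i j = 0) ->
  \det (\matrix_(i < n1 + n2, j < n1 + n2) d i j) =
  \det (\matrix_(i < n1, j < n1) d i j) *
  \det (\matrix_(i < n2, j < n2) d (n1 + i)%N (n1 + j)%N).
Proof.
move=> d0; rewrite -(det_lblock _ (\matrix_(i, j) d (n1 + i)%N j)).
congr (\det _).
apply/matrixP => i j; rewrite -(splitK i) -(splitK j).
case: (split i) => i'; case: (split j) => j' /=;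
  rewrite ?(block_mxEul, block_mxEur, block_mxEdl, block_mxEdr) !mxE //=.
by rewrite d0 ?ltn_ord ?leq_addr ?ltn_add2l.
Qed.

(** In size [n.+1], expansion along the first row leaves only the last column, with sign
    [(-1) ^+ n]; Pascal's rule adds up these exponents. *)
Lemma det_antidiag (a : K) n :
  \det (\matrix_(i < n, j < n) (if (i + j).+1 == n then a else 0))
  = (-1) ^+ 'C(n, 2) * a ^+ n.
Proof.
elim: n => [|n IHn]; first by rewrite det_mx00 mul1r.
rewrite (expand_det_row _ ord0) (bigD1 ord_max) //= big1 => [|j ne_jn].
  rewrite addr0 !mxE /= add0n eqxx /cofactor add0n /=.
  rewrite (_ : row' ord0 (col' ord_max _) = \matrix_(i < n, j < n)
                            (if (i + j).+1 == n then a else 0)).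
    by rewrite IHn binS bin1 exprS [in RHS]exprD; ring.
  apply/matrixP => i j; rewrite !mxE /= /bump /=.
  by rewrite leqNgt ltn_ord add0n add1n addSn eqSS.
rewrite !mxE add0n eqSS.
by rewrite (negPf (ne_jn : nat_of_ord j != n)) mul0r.
Qed.

End NatMatrixDet.

(** * Triangular factorization of the Hankel matrix *)

Section HankelFactorization.
Variables (K : comNzRingType) (m : nat) (b : K).
Hypothesis m_gt0 : (0 < m)%N.

Definition level (i : nat) : nat := ((i %/ m).*2 + (i %% m != 0))%N.

Definition lowf (i k : nat) : K :=
  if (i == k %[mod m])%N then dyck b (level i) (level k) else 0.

Definition midf (k l : nat) : K :=
  if (m %| k + l)%N && (k %/ m == l %/ m)%N then b ^+ level k else 0.

(** With equal residues, [i < k] forces a smaller quotient, hence a smaller level, and a path cannot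
    climb above its length. *)
Lemma lowf_gt i k : (i < k)%N -> lowf i k = 0.
Proof.
rewrite /lowf; case: eqP => // eq_ik lt_ik; apply: dyck_gt.
rewrite /level eq_ik ltn_add2r ltn_double.
have := divn_eq i m; have := divn_eq k m; rewrite eq_ik.
by nia.
Qed.

Lemma lowf_diag i : lowf i i = 1.
Proof. by rewrite /lowf eqxx dyck_diag. Qed.

(** The index of the same block with opposite residue. The outer [%% m] keeps residue 0 fixed
    instead of sending it to the next block. *)
Definition mirror (k : nat) : nat := (m * (k %/ m) + (m - k %% m) %% m)%N.

Lemma mirror_div k : (mirror k %/ m)%N = (k %/ m)%N.
Proof.
by rewrite /mirror mulnC divnMDl // (divn_small (ltn_pmod _ m_gt0)) addn0.
Qed.

Lemma mirror_mod k : (mirror k %% m)%N = ((m - k %% m) %% m)%N.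
Proof. by rewrite /mirror mulnC modnMDl modn_mod. Qed.

Lemma dvdn_add_mod k l :
  (m %| k + l)%N = (l %% m == (m - k %% m) %% m)%N.
Proof.
have ltk : (k %% m < m)%N by rewrite ltn_mod.
rewrite -(eqn_modDl (k %% m)) subnKC 1?ltnW // modnn modnDml.
by [].
Qed.

Lemma level_mirror k : level (mirror k) = level k.
Proof.
rewrite /level mirror_div mirror_mod; congr (_ + nat_of_bool (~~ _))%N.
have := ltn_pmod k m_gt0; case: (k %% m)%N => [|r] ltr.
  by rewrite subn0 modnn.
by rewrite modn_small; lia.
Qed.

Lemma midfE k l : midf k l = if (l == mirror k)%N then b ^+ level k else 0.
Proof.
rewrite /midf dvdn_add_mod -mirror_mod -(mirror_div k).
congr (if _ then _ else _); apply/andP/eqP => [[/eqP eqm /eqP eqd] | ->].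
  by rewrite (divn_eq l m) (divn_eq (mirror k) m) eqm eqd.
by rewrite !eqxx.
Qed.

(** Opposite nonzero residues add up to [m]: they raise the quotient of the sum by one, and each
    raises its own level by one. *)
Lemma level_add i j : (m %| i + j)%N ->
  (level i + level j)%N = ((i + j) %/ m).*2.
Proof.
rewrite dvdn_add_mod => /eqP eqj.
have -> : (i + j = (i %/ m + j %/ m) * m + (i %% m + j %% m))%N.
  by rewrite {1}(divn_eq i m) {1}(divn_eq j m); lia.
rewrite /level eqj divnMDl //.
have := ltn_pmod i m_gt0; case: (i %% m)%N => [|r] ltr.
  by rewrite subn0 modnn div0n /= !addn0 doubleD.
rewrite modn_small; last by lia.
by rewrite subnKC 1?ltnW // divnn m_gt0; lia.
Qed.

(** As [k] runs through the residue class of [i], its level runs through the heights with the parity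
    of [level i], the only ones contributing to [dyck_moment]. *)
Lemma sum_lowf i j N : (i < N)%N -> (j < N)%N ->
  \sum_(k < N) lowf i k * b ^+ level k * lowf j (mirror k) = fm_sol m b (i + j)%N.
Proof.
move=> ltiN ltjN.
pose F k := lowf i k * b ^+ level k * lowf j (mirror k).
rewrite (@sum_ord_widen _ F N (m * N)); last 2 first.
- by rewrite leq_pmull.
- by move=> k leNk; rewrite /F lowf_gt ?mul0r //; lia.
have ltm := ltn_pmod i m_gt0.
rewrite (@sum_ord_residue _ F m (i %% m)%N) // => [|k /negPf ne_ki]; last first.
  by rewrite /F /lowf eq_sym ne_ki !mul0r.
have eq_mod q : ((m * q + i %% m) %% m = i %% m)%N.
  by rewrite mulnC modnMDl modn_mod.
have eq_level q : level (m * q + i %% m) = (2 * q + (i %% m != 0))%N.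
  by rewrite /level eq_mod mulnC divnMDl // (divn_small ltm) addn0 mul2n.
rewrite /fm_sol; case: ifPn => [dvd_ij | ndvd_ij]; last first.
  rewrite big1 // => q _; rewrite /F /lowf mirror_mod eq_mod -dvdn_add_mod.
  by rewrite (negPf ndvd_ij) mulr0.
pose G k := b ^+ k * dyck b (level i) k * dyck b (level j) k.
have lti : (level i < 2 * N)%N.
  by rewrite /level; have := divn_eq i m; nia.
rewrite -level_add // -(@dyck_moment _ b (2 * N)) //.
rewrite (@sum_ord_residue _ G 2 (i %% m != 0)%N) //; last 2 first.
- by case: eqP.
- move=> k ne_k; rewrite /G dyck_odd ?mulr0 ?mul0r //.
  by rewrite /level; move: ne_k; rewrite modn2; lia.
apply: eq_bigr => q _; rewrite /F /G /lowf mirror_mod eq_mod eqxx.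
rewrite -dvdn_add_mod dvd_ij level_mirror eq_level; ring.
Qed.

Lemma hankel_factor N :
  \matrix_(i < N, j < N) fm_sol m b (i + j)%N =
  (\matrix_(i < N, k < N) lowf i k) *m (\matrix_(k < N, l < N) midf k l)
    *m (\matrix_(i < N, k < N) lowf i k)^T.
Proof.
apply/matrixP => i j; rewrite -mulmxA !mxE -(@sum_lowf i j N) //.
apply: eq_bigr => k _; rewrite !mxE -mulrA; congr (_ * _).
have [ltkN | leNk] := ltnP (mirror k) N.
  rewrite (bigD1 (Ordinal ltkN)) //= !mxE midfE eqxx big1 ?addr0 // => l ne_l.
  rewrite !mxE midfE.
  by rewrite (negPf (ne_l : nat_of_ord l != mirror k)) mul0r.
(* Here truncation at [N] cuts off the column [mirror k], but the term lost is zero because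
   [j < mirror k]. *)
rewrite lowf_gt ?mulr0; last exact: leq_trans (ltn_ord j) leNk.
rewrite big1 // => l _; rewrite !mxE midfE ltn_eqF ?mul0r //.
exact: leq_trans (ltn_ord l) leNk.
Qed.

Lemma hankel_det_midf N :
  hankel_det (fm_sol m b) N = \det (\matrix_(k < N, l < N) midf k l).
Proof.
have detL : \det (\matrix_(i < N, k < N) lowf i k) = 1.
  rewrite det_trig.
    by rewrite big1 // => i _; rewrite mxE lowf_diag.
  by apply/is_trig_mxP => i j ltij; rewrite mxE lowf_gt.
by rewrite /hankel_det hankel_factor !det_mulmx det_tr detL mul1r mulr1.
Qed.

(** * Determinant of the middle factor *)

Lemma midf_lt_block n i j : (i < m * n <= j)%N -> midf i j = 0.
Proof.
move=> /andP[lti lej]; rewrite /midf.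
have : (i %/ m < n)%N by rewrite ltn_divLR // mulnC.
have : (n <= j %/ m)%N by rewrite leq_divRL // mulnC.
by move=> le1 lt2; rewrite (ltn_eqF (leq_trans lt2 le1)) andbF.
Qed.

Lemma midf_block n r s : (r < m)%N -> (s < m)%N ->
  midf (m * n + r) (m * n + s) =
  if (m %| r + s)%N then b ^+ (n.*2 + (r != 0%N)) else 0.
Proof.
move=> ltr lts; rewrite /midf /level mulnC !divnMDl // !divn_small // eqxx.
rewrite andbT modnMDl modn_small // addn0 addnACA -mulnDl.
by rewrite dvdn_addr // dvdn_mull.
Qed.

Lemma det_midf_S n :
  \det (\matrix_(k < m * n + 1, l < m * n + 1) midf k l) =
  \det (\matrix_(k < m * n, l < m * n) midf k l) * b ^+ n.*2.
Proof.
rewrite det_nat_block; last by move=> i j lt_ij _; apply: midf_lt_block lt_ij.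
by rewrite det_mx11 mxE midf_block // dvdn0 addn0.
Qed.

Lemma det_midf_block n :
  \det (\matrix_(k < m * n.+1, l < m * n.+1) midf k l) =
  \det (\matrix_(k < m * n, l < m * n) midf k l) *
  (b ^+ n.*2 * ((-1) ^+ 'C(m - 1, 2) * (b ^+ n.*2.+1) ^+ (m - 1))).
Proof.
rewrite mulnSr det_nat_block; last by move=> i j lt_ij _; apply: midf_lt_block lt_ij.
congr (_ * _); rewrite -det_antidiag.
rewrite (_ : \matrix_(i < m, j < m) _ = \matrix_(i < m, j < m)
  (if (m %| i + j)%N then b ^+ (n.*2 + (nat_of_ord i != 0%N)) else 0)); last first.
  by apply/matrixP => i j; rewrite !mxE midf_block.
pose d i j := if (m %| i + j)%N then b ^+ (n.*2 + (i != 0%N)) else 0.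
transitivity (\det (\matrix_(i < m, j < m) d i j)) => //.
have m_split : m = (1 + (m - 1))%N by rewrite subnKC.
transitivity (\det (\matrix_(i < 1 + (m - 1), j < 1 + (m - 1)) d i j)).
  by rewrite -m_split.
rewrite det_nat_block => [|i j /andP[]]; last first.
  rewrite ltnS leqn0 => /eqP-> lt0j; rewrite -m_split => ltjm.
  by rewrite /d add0n gtnNdvd.
rewrite det_mx11 mxE /d dvdn0 addn0; congr (_ * \det _).
apply/matrixP => i j; rewrite !mxE addn1.
congr (if _ then _ else _).
have lti := ltn_ord i; have ltj := ltn_ord j.
(* Both shifted residues lie between 1 and [m - 1], so their sum is a multiple of [m] only when it
   equals [m]. *)
apply/dvdnP/eqP => [[[|[|q]]] | eq_ij]; [lia | lia | nia |].
by exists 1%N; lia.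
Qed.

Lemma det_midf n :
  \det (\matrix_(k < m * n, l < m * n) midf k l) =
  (-1) ^+ ('C(m - 1, 2) * n) * b ^+ (n * (m * n - 1)).
Proof.
elim: n => [|n IHn].
  by rewrite !muln0 !expr0 mulr1 det_mx00.
rewrite det_midf_block IHn mulnSr exprD -exprM.
rewrite (_ : n.+1 * (m * n.+1 - 1) =
             n * (m * n - 1) + n.*2 + n.*2.+1 * (m - 1))%N;
  first by rewrite !exprD; ring.
case: m m_gt0 => // m' _; rewrite subn1 /=.
(* The truncated [m * n - 1] is 0 at [n = 0], so this case is separate. *)
case: n {IHn} => [|n]; first by lia.
have pred_mulS k : (m'.+1 * k.+1 - 1 = m' * k.+1 + k)%N by lia.
by rewrite !pred_mulS; lia.
Qed.

(** The row [m * n + 1], present since [1 < s], could be nonzero only in column [m * n + m - 1],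
    which [s < m] excludes. *)
Lemma det_midf_gap n s : (1 < s < m)%N ->
  \det (\matrix_(k < m * n + s, l < m * n + s) midf k l) = 0.
Proof.
move=> /andP[lt1s ltsm].
have ltN : (m * n + 1 < m * n + s)%N by rewrite ltn_add2l.
rewrite (expand_det_row _ (Ordinal ltN)) big1 // => l _; rewrite mxE /=.
suff -> : midf (m * n + 1) l = 0 by rewrite mul0r.
move: (nat_of_ord l) (ltn_ord l) => {}l lt_l.
have [ltl | lel] := ltnP l (m * n).
  rewrite /midf mulnC divnMDl // gtn_eqF ?andbF //.
  by rewrite (@leq_trans n) ?leq_addr // ltn_divLR // mulnC.
rewrite -(subnKC lel) midf_block; [|lia|lia].
by rewrite gtnNdvd //; lia.
Qed.

End HankelFactorization.

Theorem theorem5p4 (R : realType) (m : nat) (hm : (1 <= m)%N) (b : R[i]) :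
  (exists! f : fps R[i], fm_equation m b f) /\
  (forall f : fps R[i], fm_equation m b f ->
    [/\ forall n : nat, hankel_det f (m * n)%N =
          (-1) ^+ ('C(m - 1, 2) * n)%N * b ^+ (n * (m * n - 1))%N,
        forall n : nat, hankel_det f (m * n + 1)%N =
          (-1) ^+ ('C(m - 1, 2) * n)%N * b ^+ (n * (m * n + 1))%N
      & forall N : nat,
          (forall n : nat, N <> (m * n)%N /\ N <> (m * n + 1)%N) ->
          hankel_det f N = 0]).
Proof.
have sol := fm_sol_equation b hm.
split=> [|f eq_f].
  by exists (fm_sol m b); split=> // g; apply: fm_equation_uniq sol.
rewrite (fm_equation_uniq hm eq_f sol); split=> [n|n|N N_gap];
  rewrite (hankel_det_midf _ hm).
- exact: det_midf.
- rewrite det_midf_S // det_midf // -mulrA -exprD; congr (_ * b ^+ _).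
  by case: n => [|n]; nia.
rewrite (divn_eq N m) mulnC det_midf_gap // ltn_pmod // andbT.
(* The gap hypothesis at the quotient of [N] rules out the remainders 0 and 1. *)
have [] := N_gap (N %/ m)%N; rewrite {1 3}(divn_eq N m) mulnC.
by case: (N %% m)%N => [|[|s]] //; rewrite ?addn0.
Qed.
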